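(* Let $\Gamma$ be a graph and let $\lambda\neq 0$ be an eigenvalue of $\Delta$ that satisfies $|1-\lambda|=r$. Then $\Gamma$ possesses a maximal, isolated, strongly connected component that consists of at least two vertices.
   Context: A graph $\Gamma=(V,E,w)$ is a finite weighted directed graph without loops and multiple edges; $w:V\times V\to\mathbb{R}$ is the weight function, $w_{ij}$ is the weight of the directed edge from $j$ to $i$, and $w_{ij}=0$ if and only if there is no edge from $j$ to $i$ (in particular $w_{ii}=0$). Weights may be positive or negative. The in-degree of $i$ is $d_i^{\mathrm{in}}=\sum_j w_{ij}$. The normalized Laplace operator on the space $C(V)$ of complex valued functions on $V$ is $\Delta v(i)=v(i)-\frac{1}{d_i^{\mathrm{in}}}\sum_j w_{ij}v(j)$ if $d_i^{\mathrm{in}}\neq 0$ and $\Delta v(i)=0$ otherwise. For $i\in V$ put $r(i)=\frac{\sum_{j\in V}|w_{ij}|}{|d_i^{\mathrm{in}}|}$ if $d_i^{\mathrm{in}}\ne 0$ and $r(i)=0$ if $d_i^{\mathrm{in}}=0$; let $r=\max_{i\in V}r(i)$. An induced subgraph with vertex set $V'\subseteq V$ is maximal if $r(i)=r$ for all $i\in V'$, and isolated if $w_{ij}=0$ for all $i\in V'$ and $j\in V\setminus V'$. A strongly connected component is the subgraph induced on an equivalence class of the relation ''mutually reachable by directed paths'' (single vertices allowed). *)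

(* Defs.v *)
From HB Require Import structures.
From mathcomp Require Import all_boot all_order all_algebra.
From mathcomp Require Import reals complex.

Set Implicit Arguments.
Unset Strict Implicit.
Unset Printing Implicit Defensive.

Import Order.TTheory GRing.Theory Num.Theory.
Local Open Scope ring_scope.
Local Open Scope complex_scope.

(* [weight i j] is the weight of the edge from [j] to [i]; there is such an
   edge exactly when this weight is nonzero, so multiple edges cannot occur. *)
Record wdigraph (R : realType) := WDigraph {
  vertex : finType;
  weight : vertex -> vertex -> R;
  weight_loopless : forall i, weight i i = 0
}.

Section Graph.
Variables (R : realType) (G : wdigraph R).
Local Notation V := (vertex G).
Local Notation w := (@weight R G).

Definition edge : rel V := fun j i => w i j != 0.

Definition indeg (i : V) : R := \sum_j w i j.

(* The functions V -> C; [R[i]^o] provides the vector space structure. *)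
Definition laplace (v : {ffun V -> R[i]^o}) : {ffun V -> R[i]^o} :=
  [ffun i => if indeg i != 0
             then v i - (1 / indeg i)%:C * \sum_j (w i j)%:C * v j
             else 0].

Lemma laplace_is_linear : linear laplace.
Proof.
move=> a u v; apply/ffunP => i; rewrite !ffunE.
case: ifP => _; last by rewrite scaler0 addr0.
rewrite (eq_bigr (fun j => a * ((w i j)%:C * u j) + (w i j)%:C * v j)).
  rewrite big_split /= -mulr_sumr mulrDr opprD addrACA; congr (_ + _).
  by rewrite /GRing.scale /= mulrBr mulrCA.
by move=> j _; rewrite !ffunE mulrDr /GRing.scale /= mulrCA.
Qed.

HB.instance Definition _ :=
  GRing.isLinear.Build R[i] {ffun V -> R[i]^o} {ffun V -> R[i]^o} _
    laplace laplace_is_linear.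

Definition laplace_eigenvalue (lambda : R[i]) : bool :=
  passmx.leigenvalue (linfun laplace) lambda.

Lemma laplace_eigenvalueP (lambda : R[i]) :
  reflect (exists2 v, v != 0 & laplace v = lambda *: v)
          (laplace_eigenvalue lambda).
Proof.
apply: (iffP idP) => [|[v v0 Lv]].
  rewrite /laplace_eigenvalue /passmx.leigenvalue -vpick0 => v0.
  exists (vpick (passmx.leigenspace (linfun laplace) lambda)) => //.
  move: (memv_pick (passmx.leigenspace (linfun laplace) lambda)).
  by rewrite memv_ker add_lfunE opp_lfunE scale_lfunE id_lfunE lfunE
    subr_eq0 => /eqP.
rewrite /laplace_eigenvalue /passmx.leigenvalue.
apply: contraNneq v0 => E0; rewrite -memv0 -E0 memv_ker.
by rewrite add_lfunE opp_lfunE scale_lfunE id_lfunE lfunE /= Lv subrr.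
Qed.

Definition ratio (i : V) : R :=
  if indeg i != 0 then (\sum_j `|w i j|) / `|indeg i| else 0.

(* All ratios are nonnegative, so the default value 0 does not affect the
   maximum over a nonempty vertex set. *)
Definition max_ratio : R := \big[Num.max/0]_(i : V) ratio i.

Definition mutually_reachable : rel V :=
  fun i j => connect edge i j && connect edge j i.

(* Induced subgraphs are represented by their vertex sets. *)
Definition strongly_connected_component (S : {set V}) : bool :=
  S \in equivalence_partition mutually_reachable [set: V].

Definition maximal_subgraph (S : {set V}) : Prop :=
  forall i, i \in S -> ratio i = max_ratio.

Definition isolated_subgraph (S : {set V}) : Prop :=
  forall i j, i \in S -> j \notin S -> w i j = 0.

End Graph.

(* Main.v *)
Require Import Defs.
From mathcomp Require Import all_boot all_order all_algebra.
From mathcomp Require Import reals complex.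

(** The proof is a maximum principle.  Let [v] be an eigenfunction for
    [lambda] and let [i] be a vertex at which [|v|] attains its maximum
    [M > 0].  Since [lambda <> 0], the in-degree of [i] is nonzero, so the
    eigenvalue equation reads [d_i (1 - lambda) v(i) = \sum_j w_ij v(j)], and
    taking absolute values gives
      [r |d_i| M <= \sum_j |w_ij| |v(j)| <= \sum_j |w_ij| M = r(i) |d_i| M],
    which is at most [r |d_i| M].  Equality therefore holds throughout:
    [r(i) = r], and [|v|] is again [M] at every vertex with an edge to [i]
    ([maximum_principle]).

    Hence the set of maximum points of [|v|] contains all predecessors of its
    members.  In any nonempty set [A] of this kind, a vertex with the fewest
    ancestors is itself reachable from all of its ancestors, so its ancestors
    form an isolated strongly connected component contained in [A]
    ([isolated_component_in_predecessor_closed]).  This component has a second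
    vertex because nonzero in-degree forces an edge into each of its vertices,
    which comes from within the component and is not a loop. *)

Import Order.TTheory GRing.Theory Num.Theory.
Local Open Scope ring_scope.
Local Open Scope complex_scope.

Section Graph.
Variables (R : realType) (G : wdigraph R).
Implicit Types (i j k : vertex G) (A S : {set vertex G}).

Lemma ratio_le_max i : Defs.ratio i <= max_ratio G.
Proof. exact: le_bigmax. Qed.

Lemma indeg_ratioE i :
  indeg i != 0 -> Defs.ratio i * `|indeg i| = \sum_j `|weight i j|.
Proof. by move=> d0; rewrite /Defs.ratio d0 divfK ?normr_eq0. Qed.

(** The hypothesis [sub] reverses the chain
    [\sum_j |w_ij| f(j) <= r(i) |d_i| f(i) <= r |d_i| f(i)], so each of its
    inequalities, and each of the termwise inequalities behind the first one,
    is an equality. *)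
Lemma maximum_principle (f : vertex G -> R) i :
    0 < f i -> (forall j, f j <= f i) -> indeg i != 0 ->
    max_ratio G * `|indeg i| * f i <= \sum_j `|weight i j| * f j ->
  Defs.ratio i = max_ratio G /\ forall j, edge j i -> f j = f i.
Proof.
move=> fi_gt0 fmax d0 sub.
have le1 : \sum_j `|weight i j| * f j <= \sum_j `|weight i j| * f i.
  by apply: ler_sum => j _; rewrite ler_wpM2l.
have rE : Defs.ratio i = max_ratio G.
  apply/eqP; rewrite eq_le ratio_le_max /=.
  have := le_trans sub le1.
  rewrite -mulr_suml -indeg_ratioE // ler_pM2r //.
  by rewrite ler_pM2r ?normr_gt0.
split=> // j wij.
have term_ge0 k : true -> 0 <= `|weight i k| * (f i - f k).
  by move=> _; rewrite mulr_ge0 ?subr_ge0.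
have sum0 : \sum_k `|weight i k| * (f i - f k) = 0.
  apply/eqP; rewrite eq_le sumr_ge0 // andbT.
  rewrite (eq_bigr _ (fun k _ => mulrBr _ _ _)) sumrB subr_le0.
  by rewrite -mulr_suml -indeg_ratioE // rE.
have /eqP : `|weight i j| * (f i - f j) = 0 := psumr_eq0P term_ge0 sum0 isT.
by rewrite mulf_eq0 normr_eq0 (negPf wij) subr_eq0 => /eqP.
Qed.

Lemma mutually_reachable_equiv :
  {in [set: vertex G] & &, equivalence_rel (@mutually_reachable R G)}.
Proof.
move=> i j k _ _ _; rewrite /mutually_reachable connect0; split=> //.
case/andP=> ij ji; apply/andP/andP=> -[ik ki]; split.
- exact: connect_trans ji ik.
- exact: connect_trans ki ij.
- exact: connect_trans ij ik.
- exact: connect_trans ki ji.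
Qed.

Lemma connect_predecessor_closed A :
    (forall i j, i \in A -> edge j i -> j \in A) ->
  forall i j, i \in A -> connect (@edge R G) j i -> j \in A.
Proof.
move=> closedA i j Ai /connectP[p]; elim: p j => [|k p IHp] j /=.
  by move=> _ <-.
by case/andP=> jk kp def_i; apply: closedA jk; apply: IHp.
Qed.

(** The ancestors of an ancestor [j] of [i] are ancestors of [i]; if [i] has
    as few ancestors as possible, the two sets coincide, so [i] is in turn an
    ancestor of [j]. *)
Lemma isolated_component_in_predecessor_closed A i0 :
    i0 \in A -> (forall i j, i \in A -> edge j i -> j \in A) ->
  exists S, [/\ strongly_connected_component S, isolated_subgraph S,
                S \subset A & S != set0].
Proof.
move=> Ai0 closedA.
pose anc i : {set vertex G} := [set j | connect (@edge R G) j i].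
case: (@arg_minnP _ i0 (mem A) (fun i => #|anc i|) Ai0) => i /= Ai min_i.
have anc_back j : j \in anc i -> connect (@edge R G) i j.
  rewrite inE => ji; have Aj := connect_predecessor_closed _ closedA _ _ Ai ji.
  have sub : anc j \subset anc i.
    by apply/subsetP=> k; rewrite !inE => kj; apply: connect_trans kj ji.
  have /eqP eq_anc : anc j == anc i by rewrite eqEcard sub min_i.
  by have : i \in anc i by [rewrite inE connect0]; rewrite -eq_anc inE.
exists (anc i); split.
- apply/imsetP; exists i; rewrite ?inE //; apply/setP=> j; rewrite !inE /=.
  apply/idP/andP=> [ji | [] //]; split=> //.
  by apply: anc_back; rewrite inE.
- move=> k j; rewrite !inE => ki; apply: contraNeq => wkj.
  exact: connect_trans (connect1 wkj) ki.
- apply/subsetP=> j; rewrite inE.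
  exact: connect_predecessor_closed closedA _ _ Ai.
- by apply/set0Pn; exists i; rewrite inE connect0.
Qed.

Lemma isolated_card_ge2 S i :
  isolated_subgraph S -> i \in S -> indeg i != 0 -> (2 <= #|S|)%N.
Proof.
move=> isoS Si d0.
have /existsP[j wij] : [exists j, weight i j != 0].
  apply: contraNT d0 => /existsPn w0; apply/eqP/big1 => j _.
  by apply/eqP/negPn/w0.
have Sj : j \in S by apply: contraNT wij => Sj; rewrite isoS.
apply/card_gt1P; exists i, j; split=> //.
by apply: contraNneq wij => <-; rewrite weight_loopless.
Qed.

Section Eigenfunction.
Variables (lambda : R[i]) (v : {ffun vertex G -> R[i]^o}).
Hypotheses (lambda0 : lambda <> 0) (Lv : laplace v = lambda *: v).

Lemma eigenfunction_indeg i : v i != 0 -> indeg i != 0.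
Proof.
apply: contraNneq => d0; move/ffunP/(_ i)/esym/eqP: Lv.
rewrite !ffunE d0 eqxx /= scaler_eq0.
by case/orP=> /eqP // ->.
Qed.

Lemma eigenfunction_sum i : indeg i != 0 ->
  (indeg i)%:C * ((1 - lambda) * v i) = \sum_j (weight i j)%:C * v j.
Proof.
move=> d0; move/ffunP/(_ i): Lv; rewrite !ffunE d0 /GRing.scale /= => eq_i.
have dC0 : (indeg i)%:C != 0 by rewrite fmorph_eq0.
rewrite mulrBl mul1r -eq_i opprB addrCA subrr addr0 mulrA.
by rewrite div1r fmorphV divff // mul1r.
Qed.

(** The modulus of a complex number is a complex number in the ordered ring
    [R[i]]; [complex.Re] turns it into an element of [R]. *)
Definition modulus i : R := complex.Re `|v i : R[i]|.

Lemma modulusE i : (modulus i)%:C = `|v i : R[i]|.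
Proof. by rewrite /modulus normc_def. Qed.

Lemma eigenfunction_modulus_sum i :
    `|1 - lambda| = (max_ratio G)%:C -> indeg i != 0 ->
  max_ratio G * `|indeg i| * modulus i <= \sum_j `|weight i j| * modulus j.
Proof.
move=> norm_l d0.
have normC (x : R) : `|x%:C| = `|x|%:C.
  by rewrite normc_def /= expr0n addr0 sqrtr_sqr.
rewrite -lecR !rmorphM /= modulusE -norm_l -normC.
rewrite [X in X * _]mulrC -mulrA -!normrM eigenfunction_sum // rmorph_sum /=.
apply: le_trans (ler_norm_sum _ _ _) _; apply: ler_sum => j _.
by rewrite rmorphM /= modulusE normrM normC.
Qed.

End Eigenfunction.
End Graph.

Theorem proposition6p1 (R : realType) (G : wdigraph R) (lambda : R[i])
  (lambda_neq0 : lambda <> 0)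
  (lambda_eigen : laplace_eigenvalue G lambda)
  (lambda_norm : `|1 - lambda| = (max_ratio G)%:C) :
  exists S : {set vertex G},
    [/\ strongly_connected_component S,
        maximal_subgraph S,
        isolated_subgraph S
      & (2 <= #|S|)%N].
Proof.
have [v v0 Lv] := laplace_eigenvalueP G lambda lambda_eigen.
have [i1 vi1] : exists i, v i != 0.
  apply/existsP; apply: contraNT v0 => /existsPn v0.
  by apply/eqP/ffunP=> i; rewrite ffunE; apply/eqP/negPn/v0.
pose f := modulus R G v.
have f_gt0 i : (0 < f i) = (v i != 0).
  by rewrite -ltcR modulusE normr_gt0.
case: (@Order.TotalTheory.arg_maxP _ _ _ i1 predT f isT) => m _ fm_max.
have fm_gt0 : 0 < f m by apply: lt_le_trans (fm_max i1 isT); rewrite f_gt0.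
pose A := [set i | f i == f m].
have indegA i : i \in A -> indeg i != 0.
  rewrite inE => /eqP fi.
  by apply: (eigenfunction_indeg _ _ _ _ lambda_neq0 Lv); rewrite -f_gt0 fi.
have maxA i : i \in A ->
    Defs.ratio i = max_ratio G /\ forall j, edge j i -> f j = f i.
  move=> Ai; have di := indegA i Ai; move: Ai; rewrite inE => /eqP fi.
  apply: maximum_principle => // [|j|]; rewrite ?fi //; first exact: fm_max.
  by rewrite -fi; apply: eigenfunction_modulus_sum Lv _ lambda_norm di.
have Am : m \in A by rewrite inE.
have closedA i j : i \in A -> edge j i -> j \in A.
  by move=> Ai /(proj2 (maxA i Ai)) fj; move: Ai; rewrite !inE fj.
have [S [sccS isoS /subsetP SA /set0Pn[i Si]]] :=
  isolated_component_in_predecessor_closed R G A m Am closedA.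
exists S; split=> //.
- by move=> j /SA /maxA[].
- exact: isolated_card_ge2 isoS Si (indegA i (SA i Si)).
Qed.
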